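(* The set of indices of computable lattices that are complete is $\Pi^1_1$-hard.
   Context: A computable lattice $(L,\preceq)$ has underlying set $L=\omega$ and a computable lattice ordering $\preceq$, formally a computable subset of $\omega^2$. An index of a computable lattice is a number $e$ such that the partial computable function $\varphi_e$ is (total and is) the characteristic function of a lattice ordering $\preceq\subseteq\omega^2$ on $\omega$. A lattice $(L,\preceq)$ is complete if for each subset $S\subseteq L$, both $\sup S$ and $\inf S$ exist. A set $C\subseteq\omega$ is $\Pi^1_1$ if it has the form $\{n\in\omega\mid \forall f\in\omega^\omega\ \varphi_e^f(n)\downarrow\}$ for some $e$. A set $A\subseteq\omega$ is $\Pi^1_1$-hard if every $\Pi^1_1$ set is $m$-reducible to $A$, i.e. for each $\Pi^1_1$ set $C$ there is a computable function $f$ such that for all $n$, $n\in C$ iff $f(n)\in A$. *)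

(* Defs.v *)
From Stdlib Require Import Arith Cantor Relation_Definitions.

(** Kleene's partial recursive functions relative to an oracle, presented as
    unary functions: tuples of arguments are coded by the Cantor bijection
    between [nat * nat] and [nat], whose two projections are taken as basic
    functions. *)

Definition pair (x y : nat) : nat := Cantor.to_nat (x, y).

Inductive code : Set :=
| Zero | Succ | Left | Right | Oracle
| Pair (a b : code)
| Comp (a b : code)
| Prec (a b : code)
| Mu (a : code).

(** [eval g c x y]: the program [c] with oracle [g] halts on input [x] with
    output [y].  [Prec a b] maps [pair p n] to the [n]-th value of
    [h 0 = a p], [h (S m) = b (pair p (pair m (h m)))]; [Mu a] maps [x] to the
    least [y] with [a (pair x y) = 0], all the smaller values being defined. *)
Fixpoint eval (g : nat -> nat) (c : code) (x y : nat) {struct c} : Prop :=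
  match c with
  | Zero => y = 0
  | Succ => y = S x
  | Left => y = fst (Cantor.of_nat x)
  | Right => y = snd (Cantor.of_nat x)
  | Oracle => y = g x
  | Pair a b => exists u v, eval g a x u /\ eval g b x v /\ y = pair u v
  | Comp a b => exists u, eval g b x u /\ eval g a u y
  | Prec a b =>
      let p := fst (Cantor.of_nat x) in
      (fix rec (n z : nat) {struct n} : Prop :=
         match n with
         | 0 => eval g a p z
         | S m => exists u, rec m u /\ eval g b (pair p (pair m u)) z
         end) (snd (Cantor.of_nat x)) y
  | Mu a =>
      eval g a (pair x y) 0 /\
      forall j, j < y -> exists v, eval g a (pair x j) (S v)
  end.

Fixpoint encode (c : code) : nat :=
  match c with
  | Zero => pair 0 0
  | Succ => pair 1 0
  | Left => pair 2 0
  | Right => pair 3 0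
  | Oracle => pair 4 0
  | Pair a b => pair 5 (pair (encode a) (encode b))
  | Comp a b => pair 6 (pair (encode a) (encode b))
  | Prec a b => pair 7 (pair (encode a) (encode b))
  | Mu a => pair 8 (encode a)
  end.

(** The graph of [phi_e^g].  If [e] codes no program, then [phi_e^g] is
    nowhere defined. *)
Definition phi_oracle (e : nat) (g : nat -> nat) (x y : nat) : Prop :=
  exists c, encode c = e /\ eval g c x y.

(** As usual, [phi_e] is [phi_e^g] for the empty oracle, i.e. [g = 0]. *)
Definition phi (e x y : nat) : Prop := phi_oracle e (fun _ => 0) x y.

Lemma encode_inj (c d : code) : encode c = encode d -> c = d.
Proof.
  revert d; induction c; intros []; cbn [encode]; unfold pair; intro H;
    apply Cantor.to_nat_inj in H; try discriminate H; try reflexivity;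
    pose proof (f_equal snd H) as H'; cbn [snd] in H';
    try (apply Cantor.to_nat_inj, pair_equal_spec in H'; destruct H');
    f_equal; auto.
Qed.

Lemma eval_functional (g : nat -> nat) (c : code) (x y z : nat) :
  eval g c x y -> eval g c x z -> y = z.
Proof.
  revert x y z; induction c as
    [| | | | |a IHa b IHb|a IHa b IHb|a IHa b IHb|a IHa]; intros x y z;
    cbn [eval]; try congruence.
  - intros (u & v & Hu & Hv & ->) (u' & v' & Hu' & Hv' & ->).
    now rewrite (IHa _ _ _ Hu Hu'), (IHb _ _ _ Hv Hv').
  - intros (u & Hu & Hy) (u' & Hu' & Hz).
    rewrite (IHb _ _ _ Hu Hu') in Hy. exact (IHa _ _ _ Hy Hz).
  - generalize (snd (Cantor.of_nat x)); intro n; revert y z.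
    induction n as [|n IHn]; intros y z; [apply IHa|].
    intros (u & Hu & Hy) (u' & Hu' & Hz).
    rewrite (IHn _ _ Hu Hu') in Hy. exact (IHb _ _ _ Hy Hz).
  - intros [Hy Ly] [Hz Lz].
    destruct (Nat.lt_trichotomy y z) as [H|[H|H]]; [|exact H|].
    + destruct (Lz y H) as [v Hv]. discriminate (IHa _ _ _ Hy Hv).
    + destruct (Ly z H) as [v Hv]. discriminate (IHa _ _ _ Hz Hv).
Qed.

Lemma phi_oracle_functional (e : nat) (g : nat -> nat) (x y z : nat) :
  phi_oracle e g x y -> phi_oracle e g x z -> y = z.
Proof.
  intros (c & Hc & Hy) (d & Hd & Hz).
  rewrite <- Hd in Hc; apply encode_inj in Hc; subst d.
  exact (eval_functional _ _ _ _ _ Hy Hz).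
Qed.

Definition computable (f : nat -> nat) : Prop :=
  exists e, forall n, phi e n (f n).

Definition Pi11 (C : nat -> Prop) : Prop :=
  exists e, forall n,
    C n <-> forall f : nat -> nat, exists v, phi_oracle e f n v.

Definition m_reducible (C A : nat -> Prop) : Prop :=
  exists f, computable f /\ forall n, C n <-> A (f n).

Definition Pi11_hard (A : nat -> Prop) : Prop :=
  forall C, Pi11 C -> m_reducible C A.

Definition is_sup {T : Type} (R : relation T) (S : T -> Prop) (s : T) : Prop :=
  (forall x, S x -> R x s) /\ (forall u, (forall x, S x -> R x u) -> R s u).

Definition is_inf {T : Type} (R : relation T) (S : T -> Prop) (i : T) : Prop :=
  (forall x, S x -> R i x) /\ (forall l, (forall x, S x -> R l x) -> R l i).

Definition lattice_order {T : Type} (R : relation T) : Prop :=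
  order T R /\
  forall a b, (exists s, is_sup R (fun x => x = a \/ x = b) s) /\
              (exists i, is_inf R (fun x => x = a \/ x = b) i).

Definition complete_order {T : Type} (R : relation T) : Prop :=
  forall S : T -> Prop, (exists s, is_sup R S s) /\ (exists i, is_inf R S i).

(** [phi_e] is total and is the characteristic function of [R], a subset of
    [nat * nat] (coded by the Cantor bijection). *)
Definition decides (e : nat) (R : relation nat) : Prop :=
  forall x y, (R x y /\ phi e (pair x y) 1) \/ (~ R x y /\ phi e (pair x y) 0).

Definition index_of_lattice (e : nat) (R : relation nat) : Prop :=
  decides e R /\ lattice_order R.

Definition complete_lattice_index (e : nat) : Prop :=
  exists R : relation nat, index_of_lattice e R /\ complete_order R.

(* Main.v *)
Require Import Defs.
From Stdlib Require Import Arith Lia Cantor Relation_Definitions.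
From Stdlib Require Import Classical ClassicalEpsilon.

(** Fix a program [c].  Call a finite string of numbers live (for [n]) if [c]
    on input [n] does not halt when its oracle is read only through the string
    and every unbounded search is cut at the length of the string.  A
    halting computation uses finitely much of its oracle, so [c] halts on [n]
    for every oracle iff no infinite sequence has all its initial segments
    live ([approx_sound], [approx_complete]).

    The live strings are made into a linear order of Kleene-Brouwer type: a
    string is below its initial segments, and otherwise strings are compared
    at the first place where they differ.  In the absence of an infinite branch
    this is a well-order.  A branch gives a descending sequence, but such a
    sequence may still have an infimum.  Hence each string is replaced by
    infinitely many points, arranged increasingly: a lower bound of the points
    on a branch can then always be moved up within its own string, so no lower
    bound is greatest ([le_key_incomplete]).  A well-order with a greatest
    element, on the other hand, is complete ([le_key_complete]).

    To have [nat] as the underlying set, each number [x] codes a string, with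
    infinitely many codes for every string, and the codes of strings that are not
    live count as codes of the empty string.  The order is uniformly decidable
    in [n], because finding the first difference of two keys is a bounded search
    ([computable_leb_key]); substituting [n] into the program that decides it
    gives the reduction. *)

(** * Closure properties of the computable functions *)

Definition pl (x : nat) : nat := fst (Cantor.of_nat x).
Definition pr (x : nat) : nat := snd (Cantor.of_nat x).

Lemma pl_pair (x y : nat) : pl (pair x y) = x.
Proof. unfold pl, pair. now rewrite Cantor.cancel_of_to. Qed.

Lemma pr_pair (x y : nat) : pr (pair x y) = y.
Proof. unfold pr, pair. now rewrite Cantor.cancel_of_to. Qed.

Lemma pair_pl_pr (x : nat) : pair (pl x) (pr x) = x.
Proof.
  unfold pl, pr, pair.
  now rewrite <- surjective_pairing, Cantor.cancel_to_of.
Qed.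

Lemma pair_lt_r (x y : nat) : pair x y < pair x (S y).
Proof.
  unfold pair.
  pose proof (Cantor.to_nat_spec x y). pose proof (Cantor.to_nat_spec x (S y)).
  nia.
Qed.

Definition no_oracle : nat -> nat := fun _ => 0.

Lemma computable_iff_code (f : nat -> nat) :
  computable f <-> exists c, forall x, eval no_oracle c x (f x).
Proof.
  split.
  - intros [e He]. destruct (He 0) as (c & Hc & _).
    exists c; intro x. destruct (He x) as (d & Hd & Hx).
    rewrite <- Hd in Hc; apply encode_inj in Hc; now subst d.
  - intros [c Hc]. exists (encode c); intro x. now exists c.
Qed.

Lemma computable_ext (f g : nat -> nat) :
  (forall x, f x = g x) -> computable f -> computable g.
Proof. intros E [e He]. exists e; intro x. rewrite <- E; apply He. Qed.

Lemma computable_id : computable (fun x => x).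
Proof.
  apply computable_iff_code; exists (Pair Left Right); intro x.
  exists (pl x), (pr x). repeat split. now rewrite pair_pl_pr.
Qed.

Lemma computable_comp (f g : nat -> nat) :
  computable f -> computable g -> computable (fun x => f (g x)).
Proof.
  rewrite !computable_iff_code. intros [a Ha] [b Hb].
  exists (Comp a b); intro x. exists (g x); auto.
Qed.

Lemma computable_pair (f g : nat -> nat) :
  computable f -> computable g -> computable (fun x => pair (f x) (g x)).
Proof.
  rewrite !computable_iff_code. intros [a Ha] [b Hb].
  exists (Pair a b); intro x. exists (f x), (g x); auto.
Qed.

Lemma computable_pl (f : nat -> nat) :
  computable f -> computable (fun x => pl (f x)).
Proof.
  apply (computable_comp pl), computable_iff_code. now exists Left.
Qed.

Lemma computable_pr (f : nat -> nat) :
  computable f -> computable (fun x => pr (f x)).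
Proof.
  apply (computable_comp pr), computable_iff_code. now exists Right.
Qed.

Lemma computable_S (f : nat -> nat) :
  computable f -> computable (fun x => S (f x)).
Proof.
  apply (computable_comp S), computable_iff_code. now exists Succ.
Qed.

Fixpoint numeral (n : nat) : code :=
  match n with 0 => Zero | S m => Comp Succ (numeral m) end.

Lemma eval_numeral (g : nat -> nat) (n x : nat) : eval g (numeral n) x n.
Proof. induction n as [|n IH]; [reflexivity|]. now exists n. Qed.

Lemma computable_const (k : nat) : computable (fun _ => k).
Proof.
  apply computable_iff_code. exists (numeral k); intro x; apply eval_numeral.
Qed.

Definition computable2 (F : nat -> nat -> nat) : Prop :=
  computable (fun z => F (pl z) (pr z)).

Lemma computable_app2 (F : nat -> nat -> nat) (f g : nat -> nat) :
  computable2 F -> computable f -> computable g ->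
  computable (fun x => F (f x) (g x)).
Proof.
  intros HF Hf Hg.
  refine (computable_ext _ _ _ (computable_comp _ _ HF (computable_pair f g Hf Hg))).
  intro x. now rewrite pl_pair, pr_pair.
Qed.

Lemma computable_rec (a k : nat -> nat) (b : nat -> nat -> nat -> nat) :
  computable a -> computable k ->
  computable (fun z => b (pl z) (pl (pr z)) (pr (pr z))) ->
  computable (fun x => nat_rec (fun _ => nat) (a x) (b x) (k x)).
Proof.
  intros Ha Hk Hb.
  apply (computable_app2
    (fun x n => nat_rec (fun _ => nat) (a x) (b x) n) (fun x => x) k);
    [|exact computable_id|exact Hk].
  rewrite computable_iff_code in Ha, Hb. destruct Ha as [A HA], Hb as [B HB].
  apply computable_iff_code. exists (Prec A B); intro z; cbn [eval].
  fold (pl z) (pr z). induction (pr z) as [|n IH]; [apply HA|].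
  eexists; split; [exact IH|].
  specialize (HB (pair (pl z) (pair n
    (nat_rec (fun _ => nat) (a (pl z)) (b (pl z)) n)))).
  cbv beta in HB. now rewrite !pr_pair, !pl_pair in HB.
Qed.

Lemma computable_case (r a : nat -> nat) (f : nat -> nat -> nat) :
  computable r -> computable a -> computable2 f ->
  computable (fun x => match r x with 0 => a x | S u => f x u end).
Proof.
  intros Hr Ha Hf.
  refine (computable_ext _ _ _ (computable_rec a r (fun x m _ => f x m) Ha Hr
    (computable_app2 f pl (fun z => pl (pr z)) Hf
      (computable_pl _ computable_id)
      (computable_pl _ (computable_pr _ computable_id))))).
  intro x. now destruct (r x).
Qed.

Lemma computable_pred (f : nat -> nat) :
  computable f -> computable (fun x => Nat.pred (f x)).
Proof.
  intro Hf.
  exact (computable_case f f (fun _ u => u) Hf Hf (computable_pr _ computable_id)).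
Qed.

Lemma computable_sub (f g : nat -> nat) :
  computable f -> computable g -> computable (fun x => f x - g x).
Proof.
  intros Hf Hg.
  refine (computable_ext _ _ _ (computable_rec f g (fun _ _ r => Nat.pred r) Hf Hg
    (computable_pred _ (computable_pr _ (computable_pr _ computable_id))))).
  intro x. induction (g x) as [|n IH]; cbn [nat_rec nat_rect];
    [now rewrite Nat.sub_0_r|].
  rewrite Nat.sub_succ_r. now f_equal.
Qed.

Lemma computable_if_leb (f g a b : nat -> nat) :
  computable f -> computable g -> computable a -> computable b ->
  computable (fun x => if f x <=? g x then a x else b x).
Proof.
  intros Hf Hg Ha Hb.
  refine (computable_ext _ _ _
    (computable_case (fun x => f x - g x) a (fun x _ => b x)
      (computable_sub f g Hf Hg) Ha
      (computable_comp b pl Hb (computable_pl _ computable_id)))).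
  intro x; cbv beta. destruct (Nat.leb_spec (f x) (g x)) as [H|H].
  - now rewrite (proj2 (Nat.sub_0_le _ _) H).
  - destruct (f x - g x) eqn:E; [lia|reflexivity].
Qed.

Definition search (F : nat -> nat) (m : nat) : nat :=
  nat_rec (fun _ => nat) 0
    (fun _ h => match F h with 0 => h | S _ => S h end) m.

Lemma search_spec (F : nat -> nat) (m : nat) :
  (forall j, j < search F m -> F j <> 0) /\
  (search F m = m \/ search F m < m /\ F (search F m) = 0).
Proof.
  induction m as [|m [IH1 IH2]]; [split; [cbn; lia|now left]|].
  change (search F (S m)) with
    (match F (search F m) with 0 => search F m | S _ => S (search F m) end).
  destruct (F (search F m)) eqn:E.
  - split; [exact IH1|right; split; [lia|exact E]].
  - split; [|lia].
    intros j Hj. destruct (Nat.eq_dec j (search F m)) as [->|]; [lia|].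
    apply IH1; lia.
Qed.

Lemma search_eq (F : nat -> nat) (m y : nat) :
  y <= m -> F y = 0 -> (forall j, j < y -> F j <> 0) -> search F m = y.
Proof.
  intros Hm H0 Hl. destruct (search_spec F m) as [H1 H2].
  destruct (Nat.lt_trichotomy (search F m) y) as [H|[H|H]]; [|exact H|].
  - destruct H2 as [H2|[_ H2]]; [lia|]. now destruct (Hl _ H).
  - now destruct (H1 _ H).
Qed.

Lemma computable_search (F : nat -> nat -> nat) (k : nat -> nat) :
  computable2 F -> computable k -> computable (fun x => search (F x) (k x)).
Proof.
  intros HF Hk.
  apply (computable_rec (fun _ => 0) k
    (fun x _ h => match F x h with 0 => h | S _ => S h end));
    [apply computable_const|exact Hk|].
  pose proof (computable_pr _ (computable_pr _ computable_id)) as Hh.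
  apply (computable_case
    (fun z => F (pl z) (pr (pr z))) (fun z => pr (pr z))
    (fun z _ => S (pr (pr z)))).
  - exact (computable_app2 F pl (fun z => pr (pr z)) HF
      (computable_pl _ computable_id) Hh).
  - exact Hh.
  - apply computable_S, computable_pr, computable_pr, computable_pl,
      computable_id.
Qed.

(** * Computations with a finite part of the oracle *)

(** The value is shifted by one: [0] stands for no output and [S y] for the
    output [y].  Oracle queries at or above [l], and searches that do not
    succeed below [l], give no output, which makes the function total. *)
Fixpoint approx (l : nat) (h : nat -> nat) (c : code) (x : nat) : nat :=
  match c with
  | Zero => 1
  | Succ => S (S x)
  | Left => S (pl x)
  | Right => S (pr x)
  | Oracle => if S x <=? l then S (h x) else 0
  | Pair a b =>
      match approx l h a x with
      | 0 => 0
      | S u => match approx l h b x with 0 => 0 | S v => S (pair u v) end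
      end
  | Comp a b =>
      match approx l h b x with 0 => 0 | S u => approx l h a u end
  | Prec a b =>
      nat_rec (fun _ => nat) (approx l h a (pl x))
        (fun m r => match r with
                    | 0 => 0
                    | S u => approx l h b (pair (pl x) (pair m u))
                    end) (pr x)
  | Mu a =>
      let j := search (fun j => Nat.pred (approx l h a (pair x j))) l in
      match approx l h a (pair x j) with
      | 0 => 0
      | S v => match v with 0 => S j | S _ => 0 end
      end
  end.

Lemma approx_sound (l : nat) (h g : nat -> nat) (c : code) (x y : nat) :
  (forall i, i < l -> h i = g i) -> approx l h c x = S y -> eval g c x y.
Proof.
  intro Hg. revert x y.
  induction c as
    [| | | | |a IHa b IHb|a IHa b IHb|a IHa b IHb|a IHa]; intros x y;
    cbn [approx eval]; fold (pl x) (pr x); try congruence.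
  - destruct (Nat.leb_spec (S x) l) as [H|H]; [|discriminate].
    rewrite Hg; [congruence|lia].
  - destruct (approx l h a x) as [|u] eqn:Ea; [discriminate|].
    destruct (approx l h b x) as [|v] eqn:Eb; [discriminate|].
    intros [= <-]. exists u, v; auto.
  - destruct (approx l h b x) as [|u] eqn:Eb; [discriminate|].
    intro Ea. exists u; auto.
  - fold (pl x) (pr x). revert y.
    induction (pr x) as [|n IH]; intro y; [apply IHa|].
    cbn [nat_rec nat_rect].
    match goal with |- match ?r with _ => _ end = _ -> _ =>
      destruct r as [|u] eqn:E end; [discriminate|].
    intro Hb. exists u; split; [exact (IH _ eq_refl)|exact (IHb _ _ Hb)].
  - match goal with |- context [search ?F l] =>
      destruct (search_spec F l) as [Hlt _]; set (j := search F l) in * end.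
    destruct (approx l h a (pair x j)) as [|[|v]] eqn:Ej; try discriminate.
    intros [= <-]. split; [auto|].
    intros i Hi. specialize (Hlt i Hi); cbv beta in Hlt.
    destruct (approx l h a (pair x i)) as [|[|v]] eqn:Ei; try easy.
    exists v; auto.
Qed.

(** The use principle: a halting computation reads the oracle only below some
    [l0].  Agreement is asked below [l0] only, while [l] may be larger, so the
    output persists however the string is continued past [l0]. *)
Lemma approx_complete (g : nat -> nat) (c : code) (x y : nat) :
  eval g c x y ->
  exists l0, forall l h, l0 <= l -> (forall i, i < l0 -> h i = g i) ->
    approx l h c x = S y.
Proof.
  revert x y.
  induction c as
    [| | | | |a IHa b IHb|a IHa b IHb|a IHa b IHb|a IHa]; intros x y;
    cbn [approx eval];
    try (intros ->; exists 0; reflexivity).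
  - intros ->. exists (S x). intros l h Hl Hh.
    rewrite (proj2 (Nat.leb_le _ _) Hl). f_equal; apply Hh; lia.
  - intros (u & v & Hu & Hv & ->).
    destruct (IHa _ _ Hu) as [la Ha], (IHb _ _ Hv) as [lb Hb].
    exists (max la lb). intros l h Hl Hh.
    rewrite Ha, Hb; [reflexivity| | | |]; intros; try apply Hh; lia.
  - intros (u & Hu & Hy).
    destruct (IHa _ _ Hy) as [la Ha], (IHb _ _ Hu) as [lb Hb].
    exists (max la lb). intros l h Hl Hh.
    rewrite Hb, Ha; [reflexivity| | | |]; intros; try apply Hh; lia.
  - fold (pl x) (pr x). revert y.
    induction (pr x) as [|n IH]; intro y; [apply IHa|].
    intros (u & Hu & Hy).
    destruct (IH _ Hu) as [la Ha], (IHb _ _ Hy) as [lb Hb].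
    exists (max la lb). intros l h Hl Hh.
    cbn [nat_rec nat_rect].
    rewrite Ha, Hb; [reflexivity| | | |]; intros; try apply Hh; lia.
  - intros [Hy Hlt].
    (* one bound for the finitely many values that precede the zero *)
    assert (Hb : exists l0, forall l h, l0 <= l ->
      (forall i, i < l0 -> h i = g i) ->
      forall j, j < y -> Nat.pred (approx l h a (pair x j)) <> 0).
    { clear Hy. induction y as [|y IH]; [exists 0; lia|].
      destruct IH as [l1 H1]; [intros j Hj; apply Hlt; lia|].
      destruct (Hlt y) as [v Hv]; [lia|].
      destruct (IHa _ _ Hv) as [l2 H2].
      exists (max l1 l2). intros l h Hl Hh j Hj.
      destruct (Nat.eq_dec j y) as [->|].
      - rewrite H2; [easy|lia|intros; apply Hh; lia].
      - apply H1; [lia|intros; apply Hh; lia|lia]. }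
    destruct Hb as [l1 H1], (IHa _ _ Hy) as [l2 H2].
    exists (max y (max l1 l2)). intros l h Hl Hh.
    assert (E : approx l h a (pair x y) = 1).
    { apply H2; [lia|intros; apply Hh; lia]. }
    rewrite (search_eq _ l y); [now rewrite E|lia|now rewrite E|].
    apply H1; [lia|intros; apply Hh; lia].
Qed.

(** Iterated unpairing reads every number as an infinite sequence. *)
Definition entry (u i : nat) : nat :=
  pl (nat_rec (fun _ => nat) u (fun _ r => pr r) i).

Lemma entry_pair_0 (a u : nat) : entry (pair a u) 0 = a.
Proof. apply pl_pair. Qed.

Lemma entry_pair_S (a u i : nat) : entry (pair a u) (S i) = entry u i.
Proof.
  unfold entry. f_equal.
  induction i as [|i IH]; [apply pr_pair|].
  cbn [nat_rec nat_rect] in *. now rewrite IH.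
Qed.

Lemma exists_code (l : nat) (g : nat -> nat) :
  exists u, forall i, i < l -> entry u i = g i.
Proof.
  revert g; induction l as [|l IH]; intro g; [exists 0; lia|].
  destruct (IH (fun i => g (S i))) as [u Hu].
  exists (pair (g 0) u). intros [|i] Hi; [apply entry_pair_0|].
  rewrite entry_pair_S. apply Hu; lia.
Qed.

Lemma computable_entry (f g : nat -> nat) :
  computable f -> computable g -> computable (fun x => entry (f x) (g x)).
Proof.
  intros Hf Hg.
  apply (computable_pl
    (fun x => nat_rec (fun _ => nat) (f x) (fun _ r => pr r) (g x))).
  apply (computable_rec f g (fun _ _ r => pr r) Hf Hg).
  apply computable_pr, computable_pr, computable_pr, computable_id.
Qed.

(** Syntax-directed use of the closure lemmas.  The patterns are matched
    explicitly because plain unification would look through definitions. *)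
Ltac prove_computable :=
  lazymatch goal with
  | H : computable ?f |- computable ?f => exact H
  | |- computable (fun _ => ?k) => apply computable_const
  | |- computable (fun x => x) => apply computable_id
  | |- computable (fun x => pl (@?f x)) =>
      apply (computable_pl f); prove_computable
  | |- computable (fun x => pr (@?f x)) =>
      apply (computable_pr f); prove_computable
  | |- computable (fun x => S (@?f x)) =>
      apply (computable_S f); prove_computable
  | |- computable (fun x => Nat.pred (@?f x)) =>
      apply (computable_pred f); prove_computable
  | |- computable (fun x => pair (@?f x) (@?g x)) =>
      apply (computable_pair f g); prove_computable
  | |- computable (fun x => entry (@?f x) (@?g x)) =>
      apply (computable_entry f g); prove_computable
  | |- computable (fun x => if @?f x <=? @?g x then @?a x else @?b x) =>
      apply (computable_if_leb f g a b); prove_computable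
  | |- computable (fun x => match @?r x with 0 => @?a x | S u => @?f x u end) =>
      apply (computable_case r a f); prove_computable
  | |- computable (fun x => search (@?F x) (@?k x)) =>
      apply (computable_search F k); prove_computable
  | |- computable (fun x => nat_rec (fun _ => nat) (@?a x) (@?b x) (@?k x)) =>
      apply (computable_rec a k b); prove_computable
  | H : computable2 ?F |- computable (fun x => ?F (@?f x) (@?g x)) =>
      apply (computable_app2 F f g H); prove_computable
  | H : computable2 (fun s x => approx _ _ ?a x)
    |- computable (fun x => approx (pl (@?f x)) _ ?a (@?g x)) =>
      apply (computable_app2 _ f g H); prove_computable
  | |- computable2 _ => unfold computable2; prove_computable
  end.

(** Recursion on the fixed program [c], along the clauses of [approx], takes
    the place of a universal program. *)
Lemma computable_approx (c : code) :
  computable2 (fun s x => approx (pl s) (entry (pr s)) c x).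
Proof.
  induction c; unfold computable2; cbn [approx]; prove_computable.
Qed.

(** * The lexicographic order on keys *)

(** The shifted entries of the string coded by [x], then the terminator [0],
    then [x] for ever.  Entries are positive, so the terminator is the first
    zero; the tail makes the key determine [x], so that codes of the same string
    are compared as numbers. *)
Definition key (len : nat -> nat) (ent : nat -> nat -> nat) (x i : nat) : nat :=
  if S i <=? len x then S (ent x i) else if i <=? len x then 0 else x.

Lemma key_lt len ent x i : i < len x -> key len ent x i = S (ent x i).
Proof. intro H. unfold key. now destruct (Nat.leb_spec (S i) (len x)); [|lia]. Qed.

Lemma key_len len ent x : key len ent x (len x) = 0.
Proof.
  unfold key. destruct (Nat.leb_spec (S (len x)) (len x)); [lia|].
  now rewrite Nat.leb_refl.
Qed.

Lemma key_gt len ent x i : len x < i -> key len ent x i = x.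
Proof.
  intro H. unfold key. destruct (Nat.leb_spec (S i) (len x)); [lia|].
  destruct (Nat.leb_spec i (len x)); [lia|reflexivity].
Qed.

(** The order [1 < 2 < ... < 0], of type [omega + 1]: with [0] as infinity, the
    terminator of a string is above every entry, as the Kleene-Brouwer order
    requires, and the number [0] is the greatest code. *)
Definition wle (a b : nat) : Prop := b = 0 \/ 0 < a <= b.

Lemma wle_least (P : nat -> Prop) :
  (exists a, P a) -> exists a, P a /\ forall b, P b -> wle a b.
Proof.
  intros [a Ha].
  destruct (classic (exists b, P b /\ b <> 0)) as [Hb|Hn].
  - destruct Hb as [b [Hb Hb0]].
    induction b as [b IH] using (well_founded_induction lt_wf).
    destruct (classic (exists d, P d /\ d <> 0 /\ d < b)) as [(d & Hd)|H].
    + now apply (IH d).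
    + exists b; split; [exact Hb|]. intros d Hd. unfold wle.
      destruct (Nat.eq_dec d 0) as [|Hd0]; [now left|right].
      destruct (Nat.lt_ge_cases d b) as [Hl|]; [|lia].
      destruct H; now exists d.
  - exists a; split; [exact Ha|]. intros b Hb. left.
    destruct (Nat.eq_dec b 0) as [|Hb0]; [assumption|]. destruct Hn; now exists b.
Qed.

Definition agree (k : nat) (f g : nat -> nat) : Prop := forall i, i < k -> f i = g i.

(** The lexicographic order for [wle].  Requiring the comparison at every [i]
    below which the sequences agree, and not just at the first difference,
    covers equal sequences without a case distinction. *)
Definition lexle (f g : nat -> nat) : Prop :=
  forall i, agree i f g -> wle (f i) (g i).

(** The common induction behind antisymmetry and transitivity of [lexle]. *)
Lemma lexle_antisym_agree (f g : nat -> nat) (k : nat) :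
  (forall i, i < k -> agree i f g -> wle (f i) (g i) /\ wle (g i) (f i)) ->
  agree k f g.
Proof.
  intros H i. induction i as [i IH] using (well_founded_induction lt_wf).
  intro Hi. destruct (H i Hi) as [H1 H2].
  - intros j Hj. apply IH; lia.
  - unfold wle in *; lia.
Qed.

Lemma agree_sym k f g : agree k f g -> agree k g f.
Proof. intros H i Hi. now rewrite H. Qed.

Lemma lexle_refl f : lexle f f.
Proof. intros i _. unfold wle; lia. Qed.

Lemma lexle_trans f g h : lexle f g -> lexle g h -> lexle f h.
Proof.
  intros Hfg Hgh i Hfh.
  assert (Hi : agree i f g).
  { apply lexle_antisym_agree. intros j Hj Hj'. split; [now apply Hfg|].
    rewrite (Hfh j Hj). apply Hgh.
    intros m Hm. rewrite <- (Hj' m Hm). apply Hfh; lia. }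
  pose proof (Hfg i Hi) as H1.
  assert (H2 : wle (g i) (h i)).
  { apply Hgh. intros m Hm. rewrite <- (Hi m Hm). now apply Hfh. }
  unfold wle in *; lia.
Qed.

Lemma lexle_antisym f g : lexle f g -> lexle g f -> forall i, f i = g i.
Proof.
  intros H1 H2 i. apply (lexle_antisym_agree f g (S i)); [|lia].
  intros j _ Hj. split; [now apply H1|now apply H2, agree_sym].
Qed.

Lemma lexle_of_difference f g i :
  agree i f g -> f i <> g i -> wle (f i) (g i) -> lexle f g.
Proof.
  intros Hi Hd Hle j Hj. destruct (Nat.lt_trichotomy j i) as [H|[->|H]].
  - rewrite (Hi j H). unfold wle; lia.
  - exact Hle.
  - now destruct Hd; apply Hj.
Qed.

Lemma lexle_total f g : lexle f g \/ lexle g f.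
Proof.
  destruct (classic (lexle f g)) as [|H]; [now left|right].
  apply not_all_ex_not in H as [i H]. apply imply_to_and in H as [H1 H2].
  apply (lexle_of_difference g f i); [now apply agree_sym| |];
    unfold wle in *; lia.
Qed.

(** Dependent choice, for conditions on [f i] that involve [f] below [i]. *)
Lemma history_choice (R : nat -> (nat -> nat) -> nat -> Prop) :
  (forall i g g' a, agree i g g' -> R i g a -> R i g' a) ->
  (forall i g, exists a, R i g a) ->
  exists f, forall i, R i f (f i).
Proof.
  intros Hext Htot.
  pose (next i g := proj1_sig (constructive_indefinite_description _ (Htot i g))).
  assert (Hnext : forall i g, R i g (next i g)).
  { intros i g. unfold next. apply proj2_sig. }
  clearbody next.
  pose (hist := fix hist (i : nat) : nat -> nat :=
    match i with
    | 0 => fun _ => 0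
    | S m => fun j => if j =? m then next m (hist m) else hist m j
    end).
  exists (fun i => next i (hist i)). intro i.
  apply (Hext i (hist i)); [|apply Hnext].
  induction i as [|m IH]; intros j Hj; [lia|].
  cbn [hist]. destruct (Nat.eqb_spec j m) as [->|]; [reflexivity|].
  apply IH; lia.
Qed.

(** In the space of all sequences a nonempty set has a lexicographic infimum:
    take the least first coordinate, then the least second coordinate among the
    sequences that attain it, and so on.  Every initial segment of the
    infimum is attained in the set, though the infimum itself need not be. *)
Lemma lexle_infimum {T : Type} (k : T -> nat -> nat) (S : T -> Prop) :
  (exists x, S x) ->
  exists f,
    (forall i, exists x, S x /\ agree i (k x) f) /\
    (forall x, S x -> lexle f (k x)).
Proof.
  intro Hne.
  destruct (history_choice (fun i g a =>
    (exists x, S x /\ agree i (k x) g) ->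
    (exists x, S x /\ agree i (k x) g /\ k x i = a) /\
    (forall x, S x -> agree i (k x) g -> wle a (k x i)))) as [f Hf].
  - intros i g g' a Hg HR.
    assert (E : forall x, agree i (k x) g <-> agree i (k x) g').
    { intro x; split; intros H j Hj; [rewrite <- Hg|rewrite Hg]; auto. }
    setoid_rewrite <- E. exact HR.
  - intros i g.
    destruct (classic (exists x, S x /\ agree i (k x) g)) as [(x & Hx)|Hn].
    + destruct (wle_least (fun a => exists x, S x /\ agree i (k x) g /\ k x i = a))
        as (a & Ha & Hmin); [exists (k x i), x; tauto|].
      exists a. intros _. split; [exact Ha|].
      intros y Hy Hyg. apply Hmin. now exists y.
    + exists 0. tauto.
  - assert (Hap : forall i, exists x, S x /\ agree i (k x) f).
    { intro i; induction i as [|i IH].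
      - destruct Hne as [x Hx]; exists x; split; [exact Hx|intros j Hj; lia].
      - destruct (Hf i IH) as [(x & Hx & Hi & Hxi) _].
        exists x; split; [exact Hx|].
        intros j Hj. destruct (Nat.eq_dec j i) as [->|]; [exact Hxi|].
        apply Hi; lia. }
    exists f; split; [exact Hap|].
    intros x Hx i Hi. apply (Hf i (Hap i)); [exact Hx|now apply agree_sym].
Qed.

Lemma key_inj len ent x y :
  (forall i, key len ent x i = key len ent y i) -> x = y.
Proof.
  intro H. pose proof (H (S (max (len x) (len y)))) as E.
  rewrite !key_gt in E by lia. exact E.
Qed.

Definition le_key (len : nat -> nat) (ent : nat -> nat -> nat) : relation nat :=
  fun x y => lexle (key len ent x) (key len ent y).

Lemma le_key_order len ent : order nat (le_key len ent).
Proof.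
  split.
  - intro x; apply lexle_refl.
  - intros x y z; apply lexle_trans.
  - intros x y Hxy Hyx. apply (key_inj len ent), lexle_antisym; assumption.
Qed.

(** * Completeness and infinite branches *)

Lemma total_lattice_order {T : Type} (R : relation T) :
  order T R -> (forall x y, R x y \/ R y x) -> lattice_order R.
Proof.
  intros HR Htot. split; [exact HR|]. destruct HR as [refl trans antisym].
  intros a b. unfold is_sup, is_inf. destruct (Htot a b) as [H|H].
  - split; [exists b|exists a]; (split; [intros x [-> | ->]; auto|auto]).
  - split; [exists a|exists b]; (split; [intros x [-> | ->]; auto|auto]).
Qed.

Lemma well_order_with_top_complete {T : Type} (R : relation T) (top : T) :
  order T R -> (forall x, R x top) ->
  (forall S : T -> Prop, (exists x, S x) -> exists m, S m /\ forall x, S x -> R m x) ->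
  complete_order R.
Proof.
  intros [refl trans antisym] Htop Hleast S. split.
  - destruct (Hleast (fun u => forall x, S x -> R x u)) as (s & Hs & Hmin).
    { exists top; auto. }
    now exists s.
  - destruct (classic (exists x, S x)) as [Hne|Hempty].
    + destruct (Hleast S Hne) as (m & Hm & Hmin).
      exists m; split; auto.
    + exists top; split; [|auto].
      intros x Hx. destruct Hempty; now exists x.
Qed.

Lemma agree_key_entries len ent x y k :
  len x < k -> agree k (key len ent x) (key len ent y) ->
  len x = len y /\ agree (len x) (ent x) (ent y).
Proof.
  intros Hk H.
  assert (E : len x = len y).
  { destruct (Nat.lt_trichotomy (len x) (len y)) as [L|[L|L]]; [|exact L|].
    - specialize (H (len x) Hk). rewrite key_len, key_lt in H by exact L. easy.
    - specialize (H (len y) ltac:(lia)).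
      rewrite key_len, key_lt in H by exact L. easy. }
  split; [exact E|]. intros i Hi.
  specialize (H i ltac:(lia)). rewrite !key_lt in H by lia. congruence.
Qed.

(** Let [f] be the lexicographic infimum of the keys of a nonempty set.  If [f]
    has a zero, then an element whose key agrees with [f] past that zero has
    both its string and, from the next coordinate, its own value prescribed by
    [f]; so [f] is its key and it is the least element.  If [f] has no zero,
    then it describes an infinite branch. *)
Lemma le_key_complete len ent :
  len 0 = 0 ->
  (forall g, exists l, forall x, agree l (ent x) g -> len x < l) ->
  complete_order (le_key len ent).
Proof.
  intros H0 Hwf.
  apply (well_order_with_top_complete _ 0); [apply le_key_order| |].
  (* the key of 0 is identically zero, the greatest sequence *)
  { intros x i _. left. unfold key. rewrite H0. now destruct i. }
  intros S Hne.
  destruct (lexle_infimum (key len ent) S Hne) as (f & Happ & Hlow).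
  destruct (classic (exists i, f i = 0)) as [(i & Hi)|Hpos].
  -
    (* i + 2, to reach the first coordinate after the terminator *)
    destruct (Happ (i + 2)) as (x & Hx & Hxf).
    assert (Hlen : len x <= i).
    { destruct (Nat.le_gt_cases (len x) i) as [|L]; [assumption|].
      specialize (Hxf i ltac:(lia)). rewrite key_lt in Hxf by exact L. lia. }
    exists x; split; [exact Hx|].
    intros y Hy. apply (lexle_trans _ f); [|now apply Hlow].
    intros j Hj.
    assert (E : forall m, m < i + 2 -> wle (key len ent x m) (f m)).
    { intros m Hm. rewrite (Hxf m Hm). unfold wle; lia. }
    destruct (Nat.lt_ge_cases j (i + 2)) as [L|L]; [now apply E|].
    rewrite (key_gt len ent x j) by lia.
    destruct (Happ (j + 1)) as (z & Hz & Hzf).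
    assert (x = z) as <-.
    { pose proof (Hxf (i + 1) ltac:(lia)) as E1.
      pose proof (Hzf (i + 1) ltac:(lia)) as E2.
      destruct (agree_key_entries len ent x z (i + 2)) as [El _]; [lia| |].
      - intros m Hm. rewrite Hxf, Hzf by lia. reflexivity.
      - rewrite key_gt in E1, E2 by lia. congruence. }
    rewrite <- (Hzf j ltac:(lia)), key_gt by lia. unfold wle; lia.
  - exfalso.
    destruct (Hwf (fun i => Nat.pred (f i))) as [l Hl].
    destruct (Happ l) as (x & Hx & Hxf).
    assert (L : l <= len x).
    { destruct (Nat.le_gt_cases l (len x)) as [|L]; [assumption|].
      destruct Hpos. exists (len x). rewrite <- (Hxf _ L). apply key_len. }
    enough (len x < l) by lia.
    apply Hl. intros i Hi. rewrite <- (Hxf i Hi), key_lt by lia. reflexivity.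
Qed.

(** The codes of initial segments of a branch [g] have no infimum.  None
    of these codes is a lower bound, because longer segments are below it.  If
    a lower bound [s] codes another string, then a larger code [s'] of the same
    string is again a lower bound, as it is compared with the set inside the
    string, where [s] and [s'] look alike. *)
Lemma le_key_incomplete len ent g :
  len 0 = 0 ->
  (forall l, exists x, len x = l /\ agree l (ent x) g) ->
  (forall x, exists x', x < x' /\ len x' = len x /\ agree (len x) (ent x') (ent x)) ->
  ~ complete_order (le_key len ent).
Proof.
  intros H0 Hpath Hpad Hc.
  destruct (Hc (fun x => agree (len x) (ent x) g)) as [_ (s & Hlow & Hgreat)].
  destruct (classic (agree (len s) (ent s) g)) as [Hs|Hs].
  - destruct (Hpath (S (len s))) as (x & Hx & Hxg).
    assert (Hle : le_key len ent s x) by (apply Hlow; now rewrite Hx).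
    specialize (Hle (len s)). rewrite key_len, key_lt in Hle by lia.
    destruct Hle as [Hle|Hle]; [|easy|lia].
    intros i Hi. rewrite !key_lt by lia. now rewrite Hs, Hxg by lia.
  - destruct (Hpad s) as (s' & Hlt & Hlen & Hent).
    assert (Hk : agree (S (len s)) (key len ent s') (key len ent s)).
    { intros i Hi. destruct (Nat.eq_dec i (len s)) as [->|].
      - rewrite <- Hlen at 1. now rewrite !key_len.
      - rewrite !key_lt by lia. now rewrite Hent by lia. }
    assert (Hle : le_key len ent s' s).
    { apply Hgreat. intros x Hx i Hi.
      destruct (Nat.le_gt_cases i (len s)) as [L|L].
      - rewrite Hk by lia. apply (Hlow x Hx).
        intros j Hj. rewrite <- Hk by lia. now apply Hi.
      - destruct Hs.
        destruct (agree_key_entries len ent s' x i) as [E1 E2]; [lia|exact Hi|].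
        intros j Hj. rewrite <- Hent, E2 by lia. apply Hx. lia. }
    specialize (Hle (S (len s)) Hk). rewrite !key_gt in Hle by lia.
    destruct Hle as [->|Hle]; [|lia].
    destruct Hs. intros i Hi. lia.
Qed.

(** * Deciding the order *)

Definition wleb (a b : nat) : nat :=
  match b with
  | 0 => 1
  | S _ => match a with 0 => 0 | S _ => if a <=? b then 1 else 0 end
  end.

Lemma wleb_spec a b : (wle a b /\ wleb a b = 1) \/ (~ wle a b /\ wleb a b = 0).
Proof.
  unfold wle. destruct b as [|b]; [left; cbn; lia|].
  destruct a as [|a]; [right; cbn; lia|]. unfold wleb.
  destruct (Nat.leb_spec (S a) (S b)); [left|right]; lia.
Qed.

(** Zero means different, since [search] looks for zeros. *)
Definition same (a b : nat) : nat :=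
  if a <=? b then (if b <=? a then 1 else 0) else 0.

Lemma same_spec a b : same a b = 0 <-> a <> b.
Proof.
  unfold same. destruct (Nat.leb_spec a b), (Nat.leb_spec b a); lia.
Qed.

(** Keys of distinct numbers that agree up to the terminator of the first one
    have the tails [x] and [y] right after it, so the search for a difference
    can stop there; if it fails, it returns the coordinate where the tails are
    compared. *)
Definition leb_key (len : nat -> nat) (ent : nat -> nat -> nat) (x y : nat) : nat :=
  let i := search (fun i => same (key len ent x i) (key len ent y i)) (S (len x)) in
  wleb (key len ent x i) (key len ent y i).

Lemma leb_key_spec len ent x y :
  (le_key len ent x y /\ leb_key len ent x y = 1) \/
  (~ le_key len ent x y /\ leb_key len ent x y = 0).
Proof.
  unfold leb_key.
  match goal with |- context [search ?F ?m] =>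
    destruct (search_spec F m) as [Hlt Hend]; set (i := search F m) in * end.
  cbv beta zeta in *.
  assert (Hag : agree i (key len ent x) (key len ent y)).
  { intros j Hj. specialize (Hlt j Hj). rewrite same_spec in Hlt. lia. }
  assert (Hle : wle (key len ent x i) (key len ent y i) -> le_key len ent x y).
  { intro H. destruct (Nat.eq_dec (key len ent x i) (key len ent y i)) as [E|E].
    - destruct Hend as [Hend|[_ Hend]]; [|now apply same_spec in Hend].
      destruct (agree_key_entries len ent x y i) as [El _]; [lia|exact Hag|].
      rewrite !key_gt in E by lia. rewrite E. apply lexle_refl.
    - now apply (lexle_of_difference _ _ i). }
  destruct (wleb_spec (key len ent x i) (key len ent y i)) as [[H ->]|[H ->]].
  - left; auto.
  - right; split; [|reflexivity]. intro Hxy. now apply H, Hxy.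
Qed.

(** * The order attached to a program and an input *)

(** A number [pair (pair l u) t] codes the string of the first [l] entries of
    [u]; the padding [t] provides infinitely many codes of each string. *)
Definition label (x i : nat) : nat := entry (pr (pl x)) i.

(** Codes of strings along which [c] halts on [n] are cut down to the empty
    string. *)
Definition depth (c : code) (n x : nat) : nat :=
  match approx (pl (pl x)) (label x) c n with 0 => pl (pl x) | S _ => 0 end.

Lemma computable_leb_key (c : code) :
  computable (fun z => leb_key (depth c (pl z)) label (pl (pr z)) (pr (pr z))).
Proof.
  pose proof (computable_approx c) as Hc.
  unfold leb_key, wleb, same, key, depth, label. prove_computable.
Qed.

Lemma depth_zero c n : depth c n 0 = 0.
Proof. unfold depth. change (pl (pl 0)) with 0. now destruct (approx _ _ c n). Qed.

Lemma le_key_complete_iff (c : code) (n : nat) :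
  complete_order (le_key (depth c n) label) <->
  forall f, exists v, eval f c n v.
Proof.
  split.
  - intros Hc f. apply NNPP; intro Hdiv.
    apply (le_key_incomplete (depth c n) label f); [apply depth_zero| | |exact Hc].
    + intro l. destruct (exists_code l f) as [u Hu].
      exists (pair (pair l u) 0).
      assert (Hf : agree l (label (pair (pair l u) 0)) f).
      { intros i Hi. unfold label. rewrite pl_pair, pr_pair. auto. }
      split; [|exact Hf].
      unfold depth. rewrite !pl_pair.
      destruct (approx l _ c n) as [|v] eqn:E; [reflexivity|].
      destruct Hdiv. exists v. now apply (approx_sound l _ f c n v Hf).
    + intro x. exists (pair (pl x) (S (pr x))). unfold depth, agree, label.
      rewrite !pl_pair. repeat split.
      rewrite <- (pair_pl_pr x) at 1. apply pair_lt_r.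
  - intro Hhalt. apply le_key_complete; [apply depth_zero|].
    intro g. destruct (Hhalt g) as [v Hv].
    destruct (approx_complete _ _ _ _ Hv) as [l0 H0].
    exists (S l0). intros x Hx. unfold depth.
    destruct (approx (pl (pl x)) (label x) c n) eqn:E; [|lia].
    destruct (Nat.le_gt_cases l0 (pl (pl x))) as [L|L]; [|lia].
    rewrite (H0 _ (label x) L) in E; [easy|]. intros i Hi. apply Hx; lia.
Qed.

(** * The reduction *)

Definition specialize (d : code) (n : nat) : code :=
  Comp d (Pair (numeral n) (Pair Left Right)).

(** Together with [computable_encode_specialize] below, the s-m-n theorem. *)
Lemma eval_specialize g d n z v :
  eval g d (pair n z) v -> eval g (specialize d n) z v.
Proof.
  intro H. exists (pair n z); split; [|exact H].
  exists n, z. split; [apply eval_numeral|]. split; [|reflexivity].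
  exists (pl z), (pr z). repeat split. now rewrite pair_pl_pr.
Qed.

Lemma computable_encode_specialize (d : code) :
  computable (fun n => encode (specialize d n)).
Proof.
  assert (Hnum : computable (fun n => encode (numeral n))).
  { refine (computable_ext _ _ _ (computable_rec
      (fun _ => encode Zero) (fun n => n)
      (fun _ _ r => pair 6 (pair (encode Succ) r)) _ _ _)).
    - intro n. induction n as [|n IH]; [reflexivity|].
      cbn [nat_rec nat_rect numeral]. cbn [encode] in *. now rewrite <- IH.
    - apply computable_const.
    - apply computable_id.
    - prove_computable. }
  unfold specialize.
  change (computable (fun n => pair 6 (pair (encode d)
    (pair 5 (pair (encode (numeral n)) (encode (Pair Left Right))))))).
  prove_computable.
Qed.

Lemma complete_order_ext {T : Type} (R R' : relation T) :
  (forall x y, R x y <-> R' x y) -> complete_order R -> complete_order R'.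
Proof.
  intros E H S. unfold is_sup, is_inf. setoid_rewrite <- E. exact (H S).
Qed.

Lemma decides_iff (e : nat) (R : relation nat) :
  decides e R -> forall x y, R x y <-> phi e (pair x y) 1.
Proof.
  intros H x y. destruct (H x y) as [[H1 H2]|[H1 H2]]; [easy|].
  split; [easy|]. intro H3.
  discriminate (phi_oracle_functional _ _ _ _ _ H2 H3).
Qed.

(** A number that codes no program behaves like a program that never halts. *)
Lemma exists_program (e : nat) :
  exists c, forall g x y, phi_oracle e g x y <-> eval g c x y.
Proof.
  destruct (classic (exists c, encode c = e)) as [[c <-]|H].
  - exists c. intros g x y. split; [|now exists c].
    intros (d & Hd & Hy). apply encode_inj in Hd. now subst d.
  - exists (Mu Succ). intros g x y. split.
    + intros (c & Hc & _). destruct H; now exists c.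
    + intros [Hy _]. discriminate Hy.
Qed.

Theorem proposition2p4 : Pi11_hard complete_lattice_index.
Proof.
  intros C [e He]. destruct (exists_program e) as [c Hc].
  destruct (proj1 (computable_iff_code _) (computable_leb_key c)) as [d Hd].
  exists (fun n => encode (specialize d n)).
  split; [apply computable_encode_specialize|]. intro n.
  assert (Hdec : decides (encode (specialize d n)) (le_key (depth c n) label)).
  { assert (Hphi : forall x y, phi (encode (specialize d n)) (pair x y)
      (leb_key (depth c n) label x y)).
    { intros x y. exists (specialize d n); split; [reflexivity|].
      apply eval_specialize. specialize (Hd (pair n (pair x y))).
      cbv beta in Hd. now rewrite !pr_pair, !pl_pair in Hd. }
    intros x y. specialize (Hphi x y).
    destruct (leb_key_spec (depth c n) label x y) as [[H E]|[H E]];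
      rewrite E in Hphi; auto. }
  assert (HC : C n <-> complete_order (le_key (depth c n) label)).
  { rewrite He, le_key_complete_iff. now setoid_rewrite Hc. }
  rewrite HC. split.
  - intro Hcomp. exists (le_key (depth c n) label).
    split; [split; [exact Hdec|]|exact Hcomp].
    apply total_lattice_order; [apply le_key_order|].
    intros x y; apply lexle_total.
  - intros (R & [HR _] & Hcomp). revert Hcomp. apply complete_order_ext.
    intros x y. now rewrite (decides_iff _ _ HR), (decides_iff _ _ Hdec).
Qed.
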